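(* Let $X$ be a finite set of $n$ points in the plane and let $d$ be the $L_\infty$ metric restricted to $X$, i.e. $d((u_1,u_2),(v_1,v_2))=\max(|u_1-v_1|,|u_2-v_2|)$. Then in the metric space $(X,d)$ either there is a line that contains all points of $X$, or there are at least $n/37$ distinct lines. If, moreover, $|u_1-v_1|\neq|u_2-v_2|$ for every two distinct points $(u_1,u_2),(v_1,v_2)$ of $X$, then either there is a line containing all points of $X$ or there are at least $n$ distinct lines.
   Context: In a metric space $(V,\rho)$, a point $x$ is between $a$ and $b$, written $[axb]$, if $\rho(a,b)=\rho(a,x)+\rho(x,b)$. For distinct $a,b\in V$, the line determined by $a$ and $b$ is $\langle a,b\rangle=\{x\in V:[xab]\}\cup\{a\}\cup\{x\in V:[axb]\}\cup\{b\}\cup\{x\in V:[abx]\}$. Lines are compared as subsets of $V$; ''distinct lines'' means distinct sets of this form.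
   Formalization: The case n = 1 is excluded: a one-point set determines no line, so no line contains all points and the number of lines is 0, less than n/37 and less than n. *)

(* Defs.v *)
From mathcomp Require Import all_boot all_order all_algebra.
From mathcomp Require Import finmap reals.

Set Implicit Arguments.
Unset Strict Implicit.
Unset Printing Implicit Defensive.

Import Order.TTheory GRing.Theory Num.Theory.

Local Open Scope ring_scope.

Section MetricLines.
Context {R : realType} {V : finType} (rho : V -> V -> R).

(* between a x b is the relation [axb]: the middle argument is the middle
   point, which may coincide with an endpoint. *)
Definition between (a x b : V) : bool := rho a b == rho a x + rho x b.

(* Meant for a != b; that condition is imposed in [lines]. *)
Definition line (a b : V) : {set V} :=
  [set x | between x a b] :|: [set a] :|: [set x | between a x b]
    :|: [set b] :|: [set x | between a b x].

(* Lines are compared as sets of points, so #|lines| counts the distinct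
   subsets of V of the form line a b, not the pairs (a, b). *)
Definition lines : {set {set V}} :=
  [set line ab.1 ab.2 | ab : V * V & ab.1 != ab.2].

End MetricLines.

Definition dist_Linf {R : realType} (u v : R * R) : R :=
  Num.max `|u.1 - v.1| `|u.2 - v.2|.

(* The points of the metric space are the elements of the finType associated
   with the finite set X of points of the plane. *)
Definition dist_Linf_on {R : realType} (X : {fset R * R}) (x y : X) : R :=
  dist_Linf (val x) (val y).

(* Main.v *)
(** In the coordinates p = u1 + u2, q = u1 - u2 the L_infinity distance is half
    the L_1 distance, so [axb] means that x lies in the p,q-box spanned by a
    and b.  Colour a pair of points by the sign of (dp)(dq).

    If no two points share p or q, the line ab of colour k is N_k(a) :&: N_k(b),
    where N_k(x) consists of x and the points joined to x by colour k.  Lines of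
    different colours are distinct.  For n points without universal line, n
    lines are found by induction.  Twins (N_k(u) = N_k(u')) are removed, losing
    at least one line per removed point.  Without twins, take the pairs of points
    with empty box; consecutive points in the p-order and in the q-order give
    2n-2 of them.  If a < b <= c < d in the order of colour k and the lines ab
    and cd coincide, then both equal N_k(b) and N_k(c), whence b = c; so each
    line arises from at most two of these pairs, and one arising from two is
    N_k(b) with b not leftmost.  If there were fewer than n lines, all lines
    would arise twice.  Let m be the leftmost point, and write two lines mu and
    mu' of different colours as N_1(b) and N_0(b'): the colour of bb' then forces
    b' in N_1(m) or b in N_0(m), which is absurd.  (If m has no two such lines,
    the lines through m are N_k(x) for the other points x; there are n-1 of
    them, besides a line of the other colour.)

    With shared coordinates, suppose that there is no universal line and let N
    be the number of lines.  Mapping x to the line through its two neighbours in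
    its row is injective, so at most N points are interior to their row, and
    likewise for columns.  The other points form four classes (first or last in
    the row and in the column) in which no coordinate is shared.  Peeling off
    universal pairs splits such a class into a clique of either colour and a
    rest to which the first part applies.  A clique K of colour k has at most
    N + 1 points: all x in K but one admit a z of the strictly opposite colour,
    and the line xz meets K only in x.  Hence n <= 14 N + 12 <= 26 N. *)

Require Import Defs.
From mathcomp Require Import all_boot all_order all_algebra.
From mathcomp Require Import finmap reals lra zify.

Set Implicit Arguments.
Unset Strict Implicit.
Unset Printing Implicit Defensive.

Import Order.TTheory GRing.Theory Num.Theory.

(** * Lines of a two-coloured complete graph *)

Section ColourLines.
Context {T : finType} (c : rel T).
Implicit Types (S : {set T}) (a b x y z : T) (k : bool).

Definition nbh k S x : {set T} := [set z in S | (z == x) || (c z x == k)].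

Definition cline S a b : {set T} := nbh (c a b) S a :&: nbh (c a b) S b.

Definition clines S : {set {set T}} :=
  [set cline S ab.1 ab.2 | ab : T * T
     & [&& ab.1 \in S, ab.2 \in S & ab.1 != ab.2]].

Definition universal_cline S :=
  exists a b, [/\ a \in S, b \in S, a != b & cline S a b = S].

(** A single point determines no line, so cardinality one has to be excluded. *)
Definition de_bruijn_erdos S :=
  #|S| != 1 -> universal_cline S \/ #|S| <= #|clines S|.

Definition twin_free S :=
  forall k, {in S &, injective (nbh k S)}.

Lemma in_cline S a b x : (x \in cline S a b) =
  [&& x \in S, (x == a) || (c x a == c a b) & (x == b) || (c x b == c a b)].
Proof. by rewrite !inE; case: (x \in S). Qed.

Lemma mem_clines S a b :
  a \in S -> b \in S -> a != b -> cline S a b \in clines S.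
Proof. by move=> aS bS ab; apply/imsetP; exists (a, b); rewrite // inE /= aS bS. Qed.

Lemma clinesP S L : reflect
  (exists a b, [/\ a \in S, b \in S, a != b & L = cline S a b]) (L \in clines S).
Proof.
apply: (iffP imsetP) => [[[a b]]|[a [b [aS bS ab ->]]]].
  by rewrite inE /= => /and3P[aS bS ab] ->; exists a, b.
by exists (a, b); rewrite // inE /= aS bS.
Qed.

Lemma cline_subset S S' a b : S' \subset S -> cline S' a b = cline S a b :&: S'.
Proof.
move=> /subsetP sS; apply/setP => x; rewrite in_cline in_setI in_cline.
by case xS': (x \in S'); rewrite ?andbF //= (sS _ xS') andbT.
Qed.

Lemma cline_sub S a b : cline S a b \subset S.
Proof. by apply/subsetP => x; rewrite in_cline => /and3P[]. Qed.

Lemma subset_clines_card S S' : S' \subset S -> #|clines S'| <= #|clines S|.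
Proof.
move=> sS; apply: leq_trans (leq_imset_card (fun L => L :&: S') _).
apply/subset_leq_card/subsetP => L /clinesP[a [b [aS bS ab ->]]].
apply/imsetP; exists (cline S a b); last exact: cline_subset.
by apply: mem_clines => //; apply: (subsetP sS).
Qed.

Context (csym : symmetric c).

Lemma clineC S a b : cline S a b = cline S b a.
Proof. by rewrite /cline setIC csym. Qed.

Lemma cline_l S a b : a \in S -> a \in cline S a b.
Proof. by rewrite in_cline => ->; rewrite !eqxx orbT. Qed.

Lemma cline_r S a b : b \in S -> b \in cline S a b.
Proof. by rewrite clineC; apply: cline_l. Qed.

(** If the colours differed and [a != d], the pair [a], [d] would carry both of them. Hence [a = d],
    and likewise [a = e], against [d != e]. *)
Lemma cline_colour S a b d e : a \in S -> d \in S -> e \in S -> d != e ->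
  cline S a b = cline S d e -> c a b = c d e.
Proof.
move=> aS dS eS de E; case: (eqVneq (c a b) (c d e)) => // nk.
have aL : a \in cline S d e by rewrite -E cline_l.
have dL : d \in cline S a b by rewrite E cline_l.
have eL : e \in cline S a b by rewrite E cline_r.
move: aL dL eL; rewrite !in_cline => /and3P[_ ad ae] /and3P[_ da _] /and3P[_ ea _].
have {da}ad : a = d.
  apply/eqP/contraT => nad; move: ad da.
  by rewrite (eq_sym d) (negPf nad) (csym d a) => /eqP-> /eqP h; rewrite h eqxx in nk.
have {}ae : a = e.
  apply/eqP/contraT => nae; move: ae ea.
  by rewrite (eq_sym e) (negPf nae) (csym e a) => /eqP-> /eqP h; rewrite h eqxx in nk.
by rewrite -ad -ae eqxx in de.
Qed.

(** * Twins and their removal *)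

Lemma twin_colour S u u' k a : nbh k S u = nbh k S u' ->
  a \in S -> a != u -> a != u' -> c a u = c a u'.
Proof.
move=> E aS au au'; move/setP/(_ a): E; rewrite !inE aS (negPf au) (negPf au') /=.
by case: (c a u) (c a u') => [] [] //=; case: (k).
Qed.

Lemma twin_colour_self S u u' k : u \in S -> u != u' ->
  nbh k S u = nbh k S u' -> c u u' = k.
Proof.
by move=> uS uu' /setP/(_ u); rewrite !inE uS eqxx (negPf uu') => /esym/eqP.
Qed.

Lemma twin_cline S u u' k a b : nbh k S u = nbh k S u' ->
    u \in S -> u' \in S -> a \in S -> b \in S ->
    a != u' -> b != u' ->
  u' \in cline S a b -> u \in cline S a b.
Proof.
move=> E uS u'S aS bS au' bu'; rewrite !in_cline uS u'S /=.
rewrite (eq_sym u' a) (eq_sym u' b) (negPf au') (negPf bu') /= (csym u' a) (csym u' b).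
case/andP => ha hb; apply/andP; split.
- by case: eqVneq => //= ua; rewrite csym (twin_colour E aS) // eq_sym.
- by case: eqVneq => //= ub; rewrite csym (twin_colour E bS) // eq_sym.
Qed.

(** The line [cline S w u'] contains [u'] but not [u]. No line spanned by two points other than [u']
    does so, hence it is lost when [u'] is removed. *)
Lemma clines_twin_card S u u' w k : u \in S -> u' \in S -> w \in S -> u != u' ->
  nbh k S u = nbh k S u' -> w \notin nbh k S u ->
  #|clines (S :\ u')| < #|clines S|.
Proof.
move=> uS u'S wS uu' E wN.
have wu : w != u by apply: contraNneq wN => ->; rewrite inE uS eqxx.
have wu' : w != u' by apply: contraNneq wN => ->; rewrite E inE u'S eqxx.
have cuu' := twin_colour_self uS uu' E.
have cwu : c w u != k by move: wN; rewrite inE wS (negPf wu).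
set L0 := cline S w u'.
have L0S : L0 \in clines S by exact: mem_clines.
have uL0 : u \notin L0.
  rewrite in_cline uS (negPf uu') cuu' -(twin_colour E wS) //= (eq_sym k).
  by rewrite (negPf cwu) andbF.
rewrite (cardsD1 L0 (clines S)) L0S add1n ltnS.
apply: leq_trans (leq_imset_card (fun L => L :&: (S :\ u')) _).
apply/subset_leq_card/subsetP => L /clinesP[a [b [aS bS ab ->]]].
move: aS bS; rewrite !in_setD1 => /andP[au' aS] /andP[bu' bS].
apply/imsetP; exists (cline S a b); last by apply: cline_subset; apply: subD1set.
rewrite in_setD1 mem_clines // andbT.
apply: contraNneq uL0 => LE; rewrite -LE.
by apply: (twin_cline E) => //; rewrite LE cline_r.
Qed.

(** A line spanned by points other than the twins contains both twins or neither. Each of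
    [cline S w u'] and [cline S w u] contains exactly one, so two lines are lost. *)
Lemma clines_twins_card S u u' w k : u \in S -> u' \in S -> w \in S -> u != u' ->
  nbh k S u = nbh k S u' -> w \notin nbh k S u ->
  #|clines (S :\ u' :\ u)| + 2 <= #|clines S|.
Proof.
move=> uS u'S wS uu' E wN.
have wu : w != u by apply: contraNneq wN => ->; rewrite inE uS eqxx.
have wu' : w != u' by apply: contraNneq wN => ->; rewrite E inE u'S eqxx.
have cuu' := twin_colour_self uS uu' E.
have cwu : c w u != k by move: wN; rewrite inE wS (negPf wu).
set L1 := cline S w u'; set L2 := cline S w u.
have L1S : L1 \in clines S by exact: mem_clines.
have L2S : L2 \in clines S by exact: mem_clines.
have uL1 : u \notin L1.
  rewrite in_cline uS (negPf uu') cuu' -(twin_colour E wS) //= (eq_sym k).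
  by rewrite (negPf cwu) andbF.
have u'L2 : u' \notin L2.
  rewrite in_cline u'S (eq_sym u' u) (negPf uu') (csym u' u) cuu' (eq_sym k).
  by rewrite (negPf cwu) andbF.
have L12 : L1 != L2 by apply: contraNneq uL1 => ->; exact: cline_r.
rewrite (cardsD1 L1 (clines S)) L1S (cardsD1 L2 (clines S :\ L1)) in_setD1 (eq_sym L2) L12
  L2S addnA addnC leq_add2l.
apply: leq_trans (leq_imset_card (fun L => L :&: (S :\ u' :\ u)) _).
apply/subset_leq_card/subsetP => L /clinesP[a [b [aS bS ab ->]]].
move: aS bS; rewrite !in_setD1 => /and3P[au au' aS] /and3P[bu bu' bS].
apply/imsetP; exists (cline S a b); last first.
  by apply: cline_subset; apply: subset_trans (subD1set _ _) (subD1set _ _).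
rewrite !in_setD1 mem_clines // andbT; apply/andP; split.
  apply: contraNneq u'L2 => LE; rewrite -LE.
  by apply: (twin_cline (esym E)) => //; rewrite LE cline_r.
apply: contraNneq uL1 => LE; rewrite -LE.
by apply: (twin_cline E) => //; rewrite LE cline_r.
Qed.

(** Removing one twin costs at least one line, so the induction is in danger only if the smaller set
    has a universal line. When that line does not extend to [u'], both twins are removed instead. *)
Lemma twins_dbe S u u' k : u \in S -> u' \in S -> u != u' ->
    nbh k S u = nbh k S u' ->
    (forall S', S' \proper S -> de_bruijn_erdos S') ->
  de_bruijn_erdos S.
Proof.
move=> uS u'S uu' E IH _.
have cuu' := twin_colour_self uS uu' E.
have [SN|] := boolP (S \subset nbh k S u).
  left; exists u, u'; split => //; apply/eqP.
  by rewrite eqEsubset cline_sub /cline cuu' -E setIid.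
case/subsetPn => w wS wN.
have wu : w != u by apply: contraNneq wN => ->; rewrite inE uS eqxx.
have wu' : w != u' by apply: contraNneq wN => ->; rewrite E inE u'S eqxx.
set S1 := S :\ u'; set S2 := S1 :\ u.
have uS1 : u \in S1 by rewrite in_setD1 uu'.
have cS : #|S| = #|S1|.+1 by rewrite (cardsD1 u' S) u'S.
have cS1 : #|S1| = #|S2|.+1 by rewrite (cardsD1 u S1) uS1.
have lt1 : #|clines S1| < #|clines S| := clines_twin_card uS u'S wS uu' E wN.
have lt2 : #|clines S2| + 2 <= #|clines S| := clines_twins_card uS u'S wS uu' E wN.
have wS2 : w \in S2 by rewrite !in_setD1 wu wu'.
have cS2 : 0 < #|S2| by apply/card_gt0P; exists w.
have ltS1 : S1 \proper S by exact: properD1.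
have nS1 : #|S1| != 1 by rewrite cS1 eqSS -lt0n.
case: (IH S1 ltS1 nS1) => [[a [b [aS1 bS1 ab abE]]]|le1]; last first.
  by right; rewrite cS; apply: leq_ltn_trans lt1.
have sS1 : S1 \subset S by exact: subD1set.
move: (aS1) (bS1); rewrite !in_setD1 => /andP[au' aS] /andP[bu' bS].
have [u'L|u'L] := boolP (u' \in cline S a b).
  left; exists a, b; split => //; apply/eqP; rewrite eqEsubset cline_sub.
  apply/subsetP => x xS; have [->//|xu'] := eqVneq x u'.
  have : x \in S1 by rewrite in_setD1 xu'.
  by rewrite -abE (cline_subset _ _ sS1) inE => /andP[].
(* A line containing [u] and spanned by two points other than [u] also contains the twin [u']. Since
   [u'] is missing, one of the spanning points is [u]. *)
wlog au : a b aS1 bS1 ab abE au' aS bu' bS u'L / a = u.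
  move=> W; have [au|au] := eqVneq a u; first exact: (W a b).
  have [bu|bu] := eqVneq b u; first by apply: (W b a); rewrite // 1?eq_sym // clineC.
  case/negP: u'L; apply: (twin_cline (esym E)) => //.
  by move: uS1; rewrite -{1}abE (cline_subset _ _ sS1) inE => /andP[].
(* Here u and b both dominate S1 in colour ~~ k, so induction is applied to S2. *)
subst a; have bu : b != u by rewrite eq_sym.
have cub : c u b != k.
  apply: contraNneq u'L => cub; rewrite in_cline u'S cub (csym u' u) cuu' eqxx orbT.
  by rewrite csym -(twin_colour E bS) // csym cub eqxx orbT.
have dom x : x \in S1 -> ((x == u) || (c x u == ~~ k)) && ((x == b) || (c x b == ~~ k)).
  have ck : c u b = ~~ k by case: (c u b) (k) cub => [] [].
  by rewrite -{1}abE in_cline ck => /and3P[_ -> ->].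
(* If equality holds, [S] consists of [u], [u'] and [b], whose three pairs span three distinct
   lines. *)
have [S2one|nS2] := eqVneq #|S2| 1.
  right; rewrite cS cS1 S2one; apply/card_gt2P.
  exists (cline S u b), (cline S u' b), (cline S u u'); split.
    by split; apply: mem_clines => //; rewrite eq_sym.
  split; last 1 first.
  - by apply: contraNneq u'L => <-; exact: cline_r.
  - by apply: contraNneq u'L => ->; exact: cline_l.
  apply/eqP => /setP/(_ b); rewrite cline_r // in_cline bS (negPf bu) cuu'.
  by rewrite (csym b u) (negPf cub).
have ltS2 : S2 \proper S by apply: sub_proper_trans (subD1set _ _) ltS1.
case: (IH S2 ltS2 nS2) => [[d [e [dS2 eS2 de deE]]]|le2]; last first.
  by right; rewrite cS cS1; apply: leq_trans lt2; rewrite addn2.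
left; exists d, e.
have sS2 : S2 \subset S by exact: subset_trans (subD1set _ _) sS1.
move: (dS2) (eS2); rewrite !in_setD1 => /and3P[du du' dS] /and3P[eu eu' eS].
split => //; apply/eqP; rewrite eqEsubset cline_sub.
have dS1 : d \in S1 by rewrite in_setD1 du'.
have eS1 : e \in S1 by rewrite in_setD1 eu'.
have bS2 : b \in S2 by rewrite in_setD1 bu.
(* The point [b] is on this line and is joined to the rest of [S1] in colour [~~ k] only. With that
   colour the line also receives [u], and then its twin. *)
have cde : c d e = ~~ k.
  have := bS2; rewrite -{1}deE in_cline => /and3P[_].
  have /andP[_ ] := dom _ dS1; have /andP[_ ] := dom _ eS1.
  rewrite (eq_sym d b) (eq_sym e b) (csym d b) (csym e b).
  case: (eqVneq b d) => [bd|_]; case: (eqVneq b e) => [be|_] /=.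
  - by case/eqP: de; rewrite -bd.
  - by rewrite -bd => /eqP.
  - by move=> _ /eqP dk /eqP <-.
  - by move=> _ /eqP dk /eqP <-.
have uL : u \in cline S d e.
  rewrite in_cline uS cde (csym u d) (csym u e).
  have /andP[+ _] := dom _ dS1; rewrite (negPf du) /= => ->.
  by have /andP[+ _] := dom _ eS1; rewrite (negPf eu) /= => ->; rewrite !orbT.
apply/subsetP => x xS; have [->|xu'] := eqVneq x u'; first exact: (twin_cline (esym E)).
have [->//|xu] := eqVneq x u.
have : x \in S2 by rewrite !in_setD1 xu xu'.
by rewrite -deE (cline_subset _ _ sS2) inE => /andP[].
Qed.

(** The lines through [v] are the sets [nbh k S x], distinct for lack of twins, which makes
    [#|S| - 1] lines. A pair of the other colour adds one more; if there is no such pair, the lines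
    through [v] are universal. *)
Lemma card_clines_dominating S v k : twin_free S -> v \in S -> 1 < #|S| ->
    {in S, forall x, x != v -> c v x = k} ->
  universal_cline S \/ #|S| <= #|clines S|.
Proof.
move=> tf vS S1 dom.
have NvS : nbh k S v = S.
  apply/setP => x; rewrite inE; case xS: (x \in S) => //=.
  by case: eqVneq => //= xv; rewrite csym dom ?eqxx.
have lv x : x \in S -> x != v -> cline S v x = nbh k S x.
  move=> xS xv; rewrite /cline dom // NvS; apply/setIidPr.
  by apply/subsetP => y; rewrite inE => /andP[].
have [allk|] := boolP [forall x in S, forall y in S, (x != y) ==> (c x y == k)].
  have /subsetPn[x xS xv] : ~~ (S \subset [set v]).
    by apply: contraL S1 => /subset_leq_card; rewrite cards1 ltnNge => ->.
  rewrite inE in xv; left; exists v, x; split; rewrite // 1?eq_sym // lv //.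
  apply/setP => y; rewrite inE; case yS: (y \in S) => //=.
  have [//|yx] := eqVneq y x.
  by move/'forall_in_forall_inP: allk => /(_ y yS x xS); rewrite yx.
case/forall_inPn => a aS /forall_inPn[b bS]; rewrite negb_imply => /andP[ab cab].
right; set M := [set cline S v x | x in S :\ v].
have cM : #|S| = #|M|.+1.
  rewrite (cardsD1 v) vS card_in_imset // => x y.
  rewrite !in_setD1 => /andP[xv xS] /andP[yv yS]; rewrite !lv //.
  exact: tf.
have Mab : cline S a b \notin M.
  apply/imsetP => -[x]; rewrite in_setD1 => /andP[xv xS] E.
  have := cline_colour aS vS xS _ E; rewrite eq_sym => /(_ xv) h.
  by case/negP: cab; rewrite h dom.
rewrite cM; suff : #|cline S a b |: M| <= #|clines S| by rewrite cardsU1 Mab.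
apply/subset_leq_card/subsetP => L; rewrite in_setU1 => /predU1P[->|].
  exact: mem_clines.
case/imsetP => x; rewrite in_setD1 => /andP[xv xS] ->.
by apply: mem_clines; rewrite // eq_sym.
Qed.

End ColourLines.

(** * Point sets without shared coordinates *)

Section GenericPoints.
Context {T : finType} {R : realDomainType} (p q : T -> R).
Implicit Types (S : {set T}) (a b x y z : T) (k : bool) (e : T * T).

Local Open Scope ring_scope.

Definition colour x y : bool := 0 < (p x - p y) * (q x - q y).

(** For each colour this is a strict partial order, whose comparable pairs within a generic set are
    exactly the pairs of that colour. *)
Definition lt_col k x y : bool :=
  (p x < p y) && (if k then q x < q y else q y < q x).

Definition generic S := {in S &, injective p} /\ {in S &, injective q}.

Definition consecutive (f : T -> R) S : {set T * T} :=
  [set e | [&& e.1 \in S, e.2 \in S, f e.1 < f e.2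
             & [forall z in S, ~~ (f e.1 < f z < f e.2)]]].

(* Every pair is listed once, with its p-smaller point first. *)
Definition covers S : {set T * T} :=
  [set e | [&& e.1 \in S, e.2 \in S, p e.1 < p e.2
    & [forall z in S, ~~ (lt_col (colour e.1 e.2) e.1 z
                          && lt_col (colour e.1 e.2) z e.2)]]].

Local Notation nbh := (nbh colour).
Local Notation cline := (cline colour).
Local Notation clines := (clines colour).

Lemma colourC : symmetric colour.
Proof. by move=> x y; rewrite /colour -mulrNN !opprB. Qed.

Lemma colour_lt x y : p x < p y -> colour x y = (q x < q y).
Proof. by move=> xy; rewrite /colour nmulr_rgt0 ?subr_lt0. Qed.

Lemma colour_lt_col k x y : lt_col k x y -> colour x y = k.
Proof.
case/andP => xy; rewrite (colour_lt xy); case: k => // yx.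
by apply/negbTE; rewrite -leNgt ltW.
Qed.

Lemma lt_col_irr k x : lt_col k x x = false.
Proof. by rewrite /lt_col ltxx. Qed.

Lemma lt_col_trans k y x z : lt_col k x y -> lt_col k y z -> lt_col k x z.
Proof.
rewrite /lt_col => /andP[p1 q1] /andP[p2 q2]; rewrite (lt_trans p1 p2) /=.
by case: k q1 q2 => q1 q2; [apply: lt_trans q1 q2|apply: lt_trans q2 q1].
Qed.

Lemma genericS S S' : S' \subset S -> generic S -> generic S'.
Proof.
by move=> /subsetP sS [ip iq]; split=> x y /sS xS /sS yS; [apply: ip|apply: iq].
Qed.

Lemma lt_colour S x y : generic S -> x \in S -> y \in S -> p x < p y ->
  lt_col (colour x y) x y.
Proof.
case=> _ iq xS yS xy; rewrite /lt_col xy (colour_lt xy) /=.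
case: ltgtP => // qxy; move: xy; rewrite (iq x y) ?ltxx //.
Qed.

Lemma in_nbhE k S x y : generic S -> x \in S -> y \in S ->
  (x \in nbh k S y) = [|| x == y, lt_col k x y | lt_col k y x].
Proof.
move=> gS xS yS; rewrite inE xS /=; case: eqVneq => //= xy.
apply/eqP/orP => [<-|[/colour_lt_col//|/colour_lt_col]]; last by rewrite colourC.
case: (ltgtP (p x) (p y)) => [xyp|yxp|/gS.1 h].
- by left; apply: lt_colour gS _ _ _.
- by right; rewrite colourC; apply: lt_colour gS _ _ _.
- by rewrite h ?eqxx in xy.
Qed.

Lemma colour_neqE S x y : generic S -> x \in S -> y \in S -> x != y ->
  colour x y = ((p x < p y) == (q x < q y)).
Proof.
move=> gS xS yS xy; case: (ltgtP (p x) (p y)) => [xyp|yxp|/gS.1 h].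
- by rewrite colour_lt.
- rewrite colourC colour_lt //; case: ltgtP => // /gS.2 h.
  by rewrite h ?eqxx in xy.
- by rewrite h ?eqxx in xy.
Qed.

(** * Pairs with empty box *)

Lemma card_consecutive f S : {in S &, injective f} ->
  (#|S|.-1 <= #|consecutive f S|)%N.
Proof.
move=> injf; have [->|/set0Pn[x0 x0S]] := eqVneq S set0; first by rewrite cards0.
case: (arg_minP f x0S) => m mS0 mmin; have mS : m \in S by [].

have -> : #|S|.-1 = #|S :\ m| by rewrite (cardsD1 m S) mS.
(* Each point other than the minimum is the second member of the pair formed with its
   predecessor. *)
apply: leq_trans (leq_imset_card snd _); apply/subset_leq_card/subsetP => y.
rewrite in_setD1 => /andP[ym yS].
have my : (m \in S) && (f m < f y).
  rewrite mS lt_neqAle mmin // andbT; apply: contraNneq ym => /injf -> //.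
case: (@arg_maxP _ _ _ m (fun x => (x \in S) && (f x < f y)) f my) => x /andP[xS xy] xmax.
apply/imsetP; exists (x, y); rewrite // inE /= xS yS xy /=.
apply/forall_inP => z zS; apply/negP => /andP[xz zy].
have /= := xmax z; rewrite zS zy => /(_ isT).
by rewrite leNgt xz.
Qed.

(** No third point separates [x] from [y] in either coordinate, so every other point compares with
    both in the same way. *)
Lemma consecutive_twins S x y : generic S -> x \in S -> y \in S -> x != y ->
    [forall z in S, ~~ (p x < p z < p y) && ~~ (p y < p z < p x)
                 && ~~ (q x < q z < q y) && ~~ (q y < q z < q x)] ->
  nbh (colour x y) S x = nbh (colour x y) S y.
Proof.
move=> gS xS yS xy /forall_inP bet; apply/setP => z; rewrite !inE.
case zS: (z \in S) => //=.
have [->|zx] := eqVneq z x; first by rewrite (negPf xy) eqxx.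
have [->|zy] := eqVneq z y; first by rewrite colourC eqxx.
have /= -> // : colour z x = colour z y.
rewrite !(colour_neqE gS) //.
have pzx : p z != p x by apply: contraNneq zx => /gS.1 ->.
have pzy : p z != p y by apply: contraNneq zy => /gS.1 ->.
have qzx : q z != q x by apply: contraNneq zx => /gS.2 ->.
have qzy : q z != q y by apply: contraNneq zy => /gS.2 ->.
have := bet z zS.
by case: (ltgtP (p z) (p x)) pzx; case: (ltgtP (p z) (p y)) pzy;
  case: (ltgtP (q z) (q x)) qzx; case: (ltgtP (q z) (q y)) qzy.
Qed.

(** Consecutive pairs in [p] and in [q] contribute [#|S| - 1] each; a pair of both kinds would be a
    pair of twins. *)
Lemma card_covers S : generic S -> twin_free colour S ->
  ((#|S|.-1).*2 <= #|covers S|)%N.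
Proof.
move=> gS tf; have [ip iq] := gS.
(* Reorients the [q]-consecutive pairs so that the [p]-smaller point comes first. *)
pose o e := if p e.1 < p e.2 then e else (e.2, e.1).
have oinj : {in consecutive q S &, injective o}.
  move=> [x y] [x' y']; rewrite !inE /= => /and4P[_ _ xy _] /and4P[_ _ x'y' _].
  rewrite /o /=; case: ifP => _; case: ifP => _ //= [E1 E2]; subst => //.
    by have := lt_trans xy x'y'; rewrite ltxx.
  by have := lt_trans xy x'y'; rewrite ltxx.
have neqS x y : x \in S -> y \in S -> q x < q y -> p x != p y.
  by move=> xS yS; apply: contraTneq => /ip -> //; rewrite ltxx.
have disj : [disjoint consecutive p S & o @: consecutive q S].
  apply/pred0Pn => -[[x y]] /= /andP[]; rewrite inE /= => /and4P[xS yS xy /forall_inP Hp].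
  case/imsetP => -[a b]; rewrite inE /= => /and4P[aS bS ab /forall_inP Hq] E.
  have xny : x != y by apply: contraTneq xy => ->; rewrite ltxx.
  suff /tf : nbh (colour x y) S x = nbh (colour x y) S y.
    by move/(_ xS yS)/eqP; rewrite (negPf xny).
  apply: consecutive_twins => //; apply/forall_inP => z zS.
  rewrite Hp //= ; have -> /= : ~~ (p y < p z < p x).
    by apply/negP => /andP[/lt_trans h /h /(lt_trans xy)]; rewrite ltxx.
  have n2 : ~~ (q b < q z < q a).
    by apply/negP => /andP[/lt_trans h /h /(lt_trans ab)]; rewrite ltxx.
  by move: E; rewrite /o /=; case: ifP => _ [-> ->]; rewrite ?(Hq _ zS) ?n2.
have sub : consecutive p S :|: o @: consecutive q S \subset covers S.
  apply/subsetP => e; rewrite inE => /orP[].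
    rewrite !inE => /and4P[-> -> -> /forall_inP H] /=; apply/forall_inP => z /H.
    by apply: contra; rewrite /lt_col => /andP[/andP[-> _] /andP[-> _]].
  case/imsetP => -[a b]; rewrite inE /= => /and4P[aS bS ab /forall_inP H] ->.
  have := neqS _ _ aS bS ab; rewrite /o /=; case: (ltgtP (p a) (p b)) => // pab _.
    rewrite inE /= aS bS pab /=; apply/forall_inP => z /H; apply: contra.
    by rewrite /lt_col colour_lt // ab => /andP[/andP[_ ->] /andP[_ ->]].
  rewrite inE /= aS bS pab /=; apply/forall_inP => z /H; apply: contra.
  rewrite /lt_col colour_lt // (lt_gtF ab) => /andP[/andP[_ h1] /andP[_ h2]].
  by rewrite h1 h2.
apply: leq_trans (subset_leq_card sub).
rewrite cardsU disjoint_setI0 // cards0 subn0 card_in_imset //.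
by rewrite -addnn leq_add ?card_consecutive.
Qed.

(** A point below [b] is below [d] and [e], hence on the second line; a point above [b] is above
    [a], hence on the first. The same argument applies to [d]. *)
Lemma cline_chain S k a b d (e : T) : generic S ->
    a \in S -> b \in S -> d \in S -> e \in S ->
    lt_col k a b -> (b == d) || lt_col k b d -> lt_col k d e ->
    cline S a b = cline S d e ->
  nbh k S b = cline S a b /\ nbh k S d = cline S a b.
Proof.
move=> gS aS bS dS eS ab bd de E.
have inL x : x \in S -> (x \in cline S a b) = (x \in nbh k S a) && (x \in nbh k S b).
  by move=> xS; rewrite in_setI (colour_lt_col ab).
have inL' x : x \in S -> (x \in cline S a b) = (x \in nbh k S d) && (x \in nbh k S e).
  by move=> xS; rewrite E in_setI (colour_lt_col de).
have sL x k' y : x \in nbh k' S y -> x \in S by rewrite inE => /andP[].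
have sL' x : x \in cline S a b -> x \in S by move/(subsetP (cline_sub _ _ _ _)).
have up x y z : lt_col k x y -> (y == z) || lt_col k y z -> lt_col k x z.
  by move=> xy /predU1P[<-//|]; apply: lt_col_trans.
have up' x y z : (x == y) || lt_col k x y -> lt_col k y z -> lt_col k x z.
  by move=> /predU1P[->//|]; apply: lt_col_trans.
split; apply/setP => x; apply/idP/idP => [xN|xL].
- have xS := sL _ _ _ xN; move: xN; rewrite in_nbhE // => xN.
  case/orP: (xN) => [/eqP xb|/orP[xb|bx]].
  + by rewrite inL // !in_nbhE // xb eqxx ab !orbT.
  + by rewrite inL' // !in_nbhE // (up _ _ _ xb bd) (lt_col_trans (up _ _ _ xb bd) de) !orbT.
  + by rewrite inL // !in_nbhE // bx (lt_col_trans ab bx) !orbT.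
- by have xS := sL' _ xL; move: xL; rewrite inL // => /andP[].
- have xS := sL _ _ _ xN; move: xN; rewrite in_nbhE // => xN.
  case/orP: (xN) => [/eqP xd|/orP[xd|dx]].
  + by rewrite inL' // !in_nbhE // xd eqxx de !orbT.
  + by rewrite inL' // !in_nbhE // xd (lt_col_trans xd de) !orbT.
  + by rewrite inL // !in_nbhE // (up' _ _ _ bd dx) (lt_col_trans ab (up' _ _ _ bd dx)) !orbT.
- by have xS := sL' _ xL; move: xL; rewrite inL' // => /andP[].
Qed.

Lemma coversP S e : generic S -> e \in covers S -> exists k,
  [/\ e.1 \in S, e.2 \in S, colour e.1 e.2 = k, lt_col k e.1 e.2
    & {in S, forall z, lt_col k e.1 z -> lt_col k z e.2 -> False}].
Proof.
move=> gS; rewrite inE => /and4P[aS bS ab /forall_inP emp].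
exists (colour e.1 e.2); split=> //; first exact: lt_colour gS _ _ _.
by move=> z zS az zb; have := emp z zS; rewrite az zb.
Qed.

Lemma lt_col_neq k x y : lt_col k x y -> x != y.
Proof. by apply: contraTneq => ->; rewrite lt_col_irr. Qed.

(** In the order of the common colour, an overlap would put an endpoint of one pair inside the empty
    box of the other. If one pair precedes the other, [cline_chain] gives the two inner endpoints
    the same neighbourhood, so they coincide. *)
Lemma covers_linked S e e' : generic S -> twin_free colour S ->
    e \in covers S -> e' \in covers S -> e != e' ->
    cline S e.1 e.2 = cline S e'.1 e'.2 ->
  (e.2 == e'.1) || (e'.2 == e.1).
Proof.
case: e e' => [a b] [d f] gS tf /(coversP gS)[k /= [aS bS kab ab emp]].
move=> /(coversP gS)[k' /= [dS fS kdf df emp']] ee' E; have df' := lt_col_neq df.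
have kk' : k' = k by rewrite -kab -kdf (cline_colour colourC aS dS fS df' E).
rewrite {k'}kk' in kdf df emp'; have comp x y : x \in S -> y \in S ->
    x \in nbh k S y -> [|| x == y, lt_col k x y | lt_col k y x].
  by move=> xS yS; rewrite in_nbhE.
have aL := cline_l colour b aS; have bL := cline_r colourC a bS.
have dL := cline_l colour f dS; have fL := cline_r colourC d fS.
have [ad af] : a \in nbh k S d /\ a \in nbh k S f.
  by move: aL; rewrite E in_setI kdf => /andP.
have bd : b \in nbh k S d by move: bL; rewrite E in_setI kdf => /andP[].
have bf : b \in nbh k S f by move: bL; rewrite E in_setI kdf => /andP[].
have fa : f \in nbh k S a by move: fL; rewrite -E in_setI kab => /andP[].
case/or3P: (comp _ _ aS dS ad) => [/eqP adE|{}ad|{}ad].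
- case/or3P: (comp _ _ bS fS bf) => [/eqP bfE|{}bf|{}bf].
  + by case/eqP: ee'; rewrite adE bfE.
  + by case: (emp' b) => //; rewrite -adE.
  + by case: (emp f) => //; rewrite adE.
- case/or3P: (comp _ _ bS dS bd) => [->//|{}bd|{}bd]; last by case: (emp d).
  have [|Nb Nd] := cline_chain gS aS bS dS fS ab _ df E; first by rewrite bd orbT.
  by move/tf: (etrans Nb (esym Nd)) => /(_ bS dS) ->; rewrite eqxx.
- case/or3P: (comp _ _ fS aS fa) => [->|{}fa|{}fa]; rewrite ?orbT //; last by case: (emp' a).
  have [|Nb Nd] := cline_chain gS dS fS aS bS df _ ab (esym E); first by rewrite fa orbT.
  by move/tf: (etrans Nb (esym Nd)) => /(_ fS aS) ->; rewrite eqxx orbT.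
Qed.

(** Three pairwise linked pairs are impossible because [p] increases along each pair. For two pairs,
    [cline_chain] at their common point [b] identifies the line; [p x < p b] records that [b] is not
    leftmost. *)
Lemma cover_fibre S L : generic S -> twin_free colour S ->
    let F := [set e in covers S | cline S e.1 e.2 == L] in
  (#|F| <= 2)%N /\
  ((#|F| == 2)%N -> exists k b x, [/\ b \in S, x \in S, p x < p b, L = nbh k S b
      & exists y, [/\ y \in S, x != y, L = cline S x y & colour x y = k]]).
Proof.
move=> gS tf F; have inF e : (e \in F) = (e \in covers S) && (cline S e.1 e.2 == L).
  by rewrite in_set.
have link e e' : e \in F -> e' \in F -> e != e' ->
    (e.2 == e'.1) || (e'.2 == e.1).
  rewrite !inF => /andP[ec /eqP eL] /andP[ec' /eqP eL'] ee'.
  by apply: (covers_linked gS tf) => //; rewrite eL eL'.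
have irr e : e \in F -> p e.1 < p e.2.
  by rewrite inF => /andP[/(coversP gS)[k [_ _ _ /andP[]]]].
split.
  rewrite leqNgt; apply/negP => /card_gt2P[e1 [e2 [e3 [[F1 F2 F3] [n12 n23 n31]]]]].
  move: (irr _ F1) (irr _ F2) (irr _ F3)
    (link _ _ F1 F2 n12) (link _ _ F2 F3 n23) (link _ _ F3 F1 n31).
  have lra' : (1 : R) <= 0 -> False by rewrite ler10.
  by move=> i1 i2 i3 /orP[]/eqP/(congr1 p) E1 /orP[]/eqP/(congr1 p) E2 /orP[]/eqP/(congr1 p) E3;
    apply: lra'; lra.
case/cards2P => e [e' [ee' FE]].
have [eF e'F] : e \in F /\ e' \in F by rewrite FE !inE !eqxx orbT.
wlog lk : e e' ee' {FE} eF e'F / e.2 = e'.1.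
  move=> W; case/orP: (link _ _ eF e'F ee') => /eqP h; first exact: (W e e').
  by apply: (W e' e); rewrite // eq_sym.
move: eF e'F; rewrite !inF => /andP[ec /eqP eL] /andP[ec' /eqP eL'].
case: e e' ec ec' lk eL eL' {ee'} => [x b] [b' y] /= /(coversP gS)[k /= [xS bS kxb xb _]].
move=> /(coversP gS)[k' /= [bS' yS kby b_y _]] bb' eL eL'; subst b'.
have kk' : k' = k.
  by rewrite -kxb -kby (cline_colour colourC xS bS yS (lt_col_neq b_y)) // eL eL'.
rewrite {k'}kk' in kby b_y; exists k, b, x; split => //; first by case/andP: xb.
  have bb : (b == b) || lt_col k b b by rewrite eqxx.
  by have [-> _] := cline_chain gS xS bS bS yS xb bb b_y (etrans eL (esym eL')).
by exists b; split; rewrite // (lt_col_neq xb).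
Qed.

Lemma twin_free_dbe S : generic S -> twin_free colour S -> (1 < #|S|)%N ->
  universal_cline colour S \/ (#|S| <= #|clines S|)%N.
Proof.
move=> gS tf S1; have /card_gt0P[x0 x0S] : (0 < #|S|)%N by exact: ltnW.
case: (arg_minP p x0S) => m mS0 mmin; have {mS0} mS : m \in S by [].
have [|no] := boolP [exists k, forall x in S, (x != m) ==> (colour m x == k)].
  case/existsP => k /forall_inP dom; apply: (card_clines_dominating colourC (k := k) tf mS S1).
  by move=> x xS xm; apply/eqP/(implyP (dom x xS)).
right; rewrite leqNgt; apply/negP => few.
pose F L := [set e in covers S | cline S e.1 e.2 == L].
have F2 L : (#|F L| <= 2)%N by case: (cover_fibre L gS tf).
have sumF : #|covers S| = (\sum_(L in clines S) #|F L|)%N.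
  rewrite -sum1_card (partition_big (fun e => cline S e.1 e.2) (mem (clines S))) /=.
    apply: eq_bigr => L _; rewrite -sum1_card; apply: eq_bigl => e.
    by rewrite [in RHS]in_set.
  move=> e /(coversP gS)[k [aS bS _ /lt_col_neq ab _]]; exact: mem_clines.
(* A deficient line would leave at most [2 * #|clines S| - 1] covers, but there are at least
   [2 * #|S| - 2], and [#|clines S| < #|S|]. *)
have full L : L \in clines S -> #|F L| = 2%N.
  move=> LS; apply/eqP; rewrite eqn_leq F2 leqNgt; apply/negP => FL.
  have : (\sum_(L' in clines S) #|F L'| <= 1 + (#|clines S|.-1) * 2)%N.
    rewrite (bigD1 L) //=; apply: leq_add => //.
    apply: leq_trans (_ : \sum_(L' in clines S | L' != L) 2 <= _)%N.
      exact: leq_sum.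
    rewrite sum_nat_const leq_mul2r /=.
    rewrite (cardsD1 L (clines S)) LS /=; apply: subset_leq_card.
    by apply/subsetP => L'; rewrite !inE andbC.
  have := card_covers gS tf; rewrite sumF -muln2.
  have cl0 : (0 < #|clines S|)%N by apply/card_gt0P; exists L.
  move=> h1 h2; have := leq_trans h1 h2.
  rewrite -(prednK cl0) in few; rewrite -(prednK (ltnW S1)) ltnS in few.
  move=> h3; have := leq_trans (leq_mul few (leqnn 2)) h3.
  by rewrite mulSn add2n add1n ltnn.
(* A line of colour [k] through [m] arises twice, so it is [nbh k S b] for some [b] that is not
   leftmost. *)
have middle k : exists b, [/\ b \in S, b != m, b \in nbh k S m & nbh k S b \subset nbh k S m].
  have := no; rewrite negb_exists => /forallP/(_ (~~ k)).
  case/forall_inPn => u uS; rewrite negb_imply => /andP[um kmu].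
  have {}kmu : colour m u = k by case: (colour m u) (k) kmu => [] [].
  have LS : cline S m u \in clines S by apply: mem_clines; rewrite // eq_sym.
  case: (cover_fibre (cline S m u) gS tf) => _.
  rewrite -/(F _) full // => /(_ (eqxx _))[k' [b [x [bS xS xb Lb [y [yS xy Ly kxy]]]]]].
  have kk : k' = k by rewrite -kmu -kxy (cline_colour colourC mS xS yS xy).
  rewrite {k'}kk in Lb kxy; exists b; split => //.
  - by apply: contraTneq xb => ->; rewrite -leNgt mmin.
  - have : b \in cline S m u by rewrite Lb inE bS eqxx.
    by rewrite in_setI kmu => /andP[].
  - by rewrite -Lb /cline kmu subsetIl.
have [b [bS bm bN bL]] := middle true; have [b' [b'S b'm b'N b'L]] := middle false.
have excl z : z \in nbh true S m -> z \in nbh false S m -> z = m.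
  by rewrite !inE => /andP[_ /predU1P[//|/eqP h]] /andP[_ /predU1P[//|]]; rewrite h.
(* Either colour of this pair puts one of the two points into both neighbourhoods of [m]. *)
case kb : (colour b' b).
  have /(subsetP bL) h : b' \in nbh true S b by rewrite inE b'S kb eqxx orbT.
  by case/eqP: b'm; apply: excl.
have /(subsetP b'L) h : b \in nbh false S b' by rewrite inE bS colourC kb eqxx orbT.
by case/eqP: bm; apply: excl.
Qed.

Theorem generic_dbe S : generic S -> de_bruijn_erdos colour S.
Proof.
have [n] := ubnP #|S|; elim: n S => // n IH S; rewrite ltnS => Sn gS.
have [tw|tf] := boolP [exists k, exists u in S, exists u' in S,
    (u != u') && (nbh k S u == nbh k S u')].
  case/existsP: tw => k /exists_inP[u uS /exists_inP[u' u'S /andP[uu' /eqP E]]].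
  apply: (twins_dbe colourC uS u'S uu' E) => S' S'S; apply: IH.
    exact: leq_trans (proper_card S'S) Sn.
  exact: genericS (proper_sub S'S) gS.
move=> S1; case: (ltngtP #|S| 1) S1 => // [S0 _|S1 _].
  by right; move: S0; rewrite ltnS leqn0 => /eqP->.
apply: twin_free_dbe => // k u u' uS u'S E; apply: contraNeq tf => uu'.
apply/existsP; exists k; apply/exists_inP; exists u => //.
by apply/exists_inP; exists u' => //; rewrite uu' E /=.
Qed.

(** If the line of [a] and [b] is universal, both are joined to all other points in one colour and
    enlarge the clique of that colour. The final [+ 1] pays for a remaining single point, about
    which [de_bruijn_erdos] says nothing. *)
Lemma generic_peel S : generic S -> exists K : bool -> {set T},
  (forall k, K k \subset S /\ {in K k &, forall x y, x != y -> colour x y = k})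
  /\ (#|S| <= #|K true| + #|K false| + #|clines S| + 1)%N.
Proof.
have [n] := ubnP #|S|; elim: n S => // n IH S; rewrite ltnS => Sn gS.
have [S1|S1] := eqVneq #|S| 1%N.
  exists (fun _ => set0); split; last by rewrite S1 leq_addl.
  by move=> k; split; [exact: sub0set|move=> x y; rewrite inE].
have [[a [b [aS bS ab abS]]]|le] := generic_dbe gS S1; last first.
  exists (fun _ => set0); split; last by rewrite !cards0 !add0n (leq_trans le) ?leq_addr.
  by move=> k; split; [exact: sub0set|move=> x y; rewrite inE].
pose S' := S :\ a :\ b.
have S'S : S' \proper S by apply: sub_proper_trans (subD1set _ _) (properD1 aS).
have [|K [KP leK]] := IH S' _ (genericS (proper_sub S'S) gS).
  exact: leq_trans (proper_card S'S) Sn.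
have cola x : x \in S -> x != a -> colour x a = colour a b.
  by move=> xS xa; move: xS; rewrite -{1}abS in_cline (negPf xa) /= => /and3P[_ /eqP].
have colb x : x \in S -> x != b -> colour x b = colour a b.
  by move=> xS xb; move: xS; rewrite -{1}abS in_cline (negPf xb) /= => /and3P[_ _ /eqP].
have KS' k : K k \subset S' by case: (KP k).
have KS k : K k \subset S by exact: subset_trans (KS' k) (proper_sub S'S).
pose k0 := colour a b.
have aK k : a \notin K k by apply/negP => /(subsetP (KS' k)); rewrite !inE eqxx andbF.
have bK k : b \notin K k by apply/negP => /(subsetP (KS' k)); rewrite !inE eqxx.
exists (fun k => if k == k0 then a |: (b |: K k) else K k); split.
  move=> k; case: eqP => [{k}->|_]; last by split; [|case: (KP k)].
  split.
    by apply/subsetP => x; rewrite !inE => /or3P[/eqP->|/eqP->|/(subsetP (KS k0))].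
  move=> x y; rewrite !inE => xK yK xy.
  have inS z : [|| z == a, z == b | z \in K k0] -> z \in S.
    by case/or3P => [/eqP->|/eqP->|/(subsetP (KS k0))].
  have [xS yS] := (inS x xK, inS y yK).
  have [ya|ya] := eqVneq y a; first by rewrite ya cola // -ya.
  have [yb|yb] := eqVneq y b; first by rewrite yb colb // -yb.
  have [xa|xa] := eqVneq x a; first by rewrite xa colourC cola.
  have [xb|xb] := eqVneq x b; first by rewrite xb colourC colb.
  move: xK yK; rewrite (negPf xa) (negPf xb) (negPf ya) (negPf yb) /= => xK yK.
  by case: (KP k0) => _; apply.
have cS : #|S| = (#|S'| + 2)%N.
  by rewrite (cardsD1 a S) aS (cardsD1 b (S :\ a)) !inE eq_sym ab bS -/S' addn2.
have cK : #|a |: (b |: K k0)| = (#|K k0| + 2)%N.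
  by rewrite cardsU1 !inE negb_or ab aK cardsU1 bK addn2.
have mon := subset_clines_card colour (proper_sub S'S).
rewrite cS; move: cK leK mon; clear.
case: k0 => /= -> leK mon.
  move: leK mon; move: #|K true| #|K false| #|S'| #|clines S'| #|clines S| => n1 n2 n3 n4 n5.
  lia.
move: leK mon; move: #|K true| #|K false| #|S'| #|clines S'| #|clines S| => n1 n2 n3 n4 n5.
lia.
Qed.

End GenericPoints.

(** * Arbitrary point sets *)

Section BoxMetric.
Context {T : finType} {R : realType}.
Implicit Types (S : {set T}) (a b x y z : T) (k : bool) (p q : T -> R) (rho : T -> T -> R).

Local Open Scope ring_scope.

Definition in_between (f : T -> R) a x b : bool :=
  (f a <= f x <= f b) || (f b <= f x <= f a).

(* Unlike [colour], [weak_colour] holds for both colours when x and y share a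
   coordinate. *)
Definition weak_colour p q k x y : bool :=
  (p x <= p y) && (if k then q x <= q y else q y <= q x)
  || (p y <= p x) && (if k then q y <= q x else q x <= q y).

(** Only the betweenness of the metric matters below. The condition is symmetric in [p] and [q], so
    results on rows also serve for columns. *)
Definition box_metric (rho : T -> T -> R) p q :=
  forall a x b, between rho a x b = in_between p a x b && in_between q a x b.

Lemma box_metricC rho p q : box_metric rho p q -> box_metric rho q p.
Proof. by move=> rhoE a x b; rewrite rhoE andbC. Qed.

Lemma in_betweenC f a x b : in_between f a x b = in_between f b x a.
Proof. exact: orbC. Qed.

Lemma in_between_l f a b : in_between f a a b.
Proof. by rewrite /in_between !lexx andbT le_total. Qed.

Lemma in_between_r f a b : in_between f a b b.
Proof. by rewrite in_betweenC in_between_l. Qed.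

Lemma in_line rho p q a b x : box_metric rho p q ->
  (x \in line rho a b) = [|| in_between p x a b && in_between q x a b,
    in_between p a x b && in_between q a x b | in_between p a b x && in_between q a b x].
Proof.
move=> rhoE; rewrite !inE !rhoE -!orbA; congr (_ || _).
have [->|xa] := eqVneq x a; first by rewrite !in_between_l.
by have [->|xb] := eqVneq x b; rewrite //= !in_between_r.
Qed.

Lemma lineC rho p q a b : box_metric rho p q -> line rho a b = line rho b a.
Proof.
move=> rhoE; apply/setP => x; rewrite !(in_line _ _ _ rhoE).
rewrite ![in_between _ b _ a]in_betweenC ![in_between _ b a x]in_betweenC
  ![in_between _ x b a]in_betweenC.
by do 3 case: (_ && _).
Qed.

(** A point weakly comparable with both [a] and [b], in the order of their colour, is below both,
    between them or above both: the three parts of the line. *)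
Lemma in_line_strict rho p q a b x : box_metric rho p q ->
    p a != p b -> q a != q b ->
  (x \in line rho a b) =
    weak_colour p q (colour p q a b) x a && weak_colour p q (colour p q a b) x b.
Proof.
move=> rhoE; wlog pab : a b / p a < p b.
  move=> W; case: (ltgtP (p a) (p b)) => // pab _ qab; first by apply: W => //; rewrite lt_eqF.
  by rewrite (lineC _ _ rhoE) colourC andbC; apply: W; [|rewrite lt_eqF|rewrite eq_sym].
move=> _ qab; rewrite colour_lt // (in_line _ _ _ rhoE) /weak_colour /in_between.
have abs : (1 : R) <= 0 -> False by rewrite ler10.
rewrite (ltW pab) (lt_geF pab).
case: (ltgtP (q a) (q b)) qab => // qab _;
  case: (ltgtP (p x) (p a)) => pxa; case: (ltgtP (p x) (p b)) => pxb;
  case: (ltgtP (q x) (q a)) => qxa; case: (ltgtP (q x) (q b)) => qxb //=;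
  by case: abs; lra.
Qed.

(** As [q a = q b], the [q]-conditions of [[xab]] and [[abx]] hold for every [x], so these parts are
    whole half-planes. *)
Lemma in_line_row rho p q a b x : box_metric rho p q ->
    q a = q b -> p a < p b ->
  (x \in line rho a b) = [|| p x <= p a, p b <= p x | q x == q a].
Proof.
move=> rhoE qab pab; rewrite (in_line _ _ _ rhoE) /in_between qab !lexx.
rewrite (ltW pab) (lt_geF pab).
have abs : (1 : R) <= 0 -> False by rewrite ler10.
case: (ltgtP (p x) (p a)) => pxa; case: (ltgtP (p x) (p b)) => pxb;
  case: (ltgtP (q x) (q b)) => qxb //=; by case: abs; lra.
Qed.

Lemma weak_colour_generic p q k S x y : generic p q S -> x \in S -> y \in S ->
  weak_colour p q k x y = (x == y) || (colour p q x y == k).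
Proof.
move=> gS xS yS; have [->|xy] := eqVneq x y; first by rewrite /weak_colour !lexx; case: k.
rewrite (colour_neqE gS) // /weak_colour.
case: (ltgtP (p x) (p y)) => [||/gS.1 h]; last by rewrite h ?eqxx in xy.
all: case: (ltgtP (q x) (q y)) => [||/gS.2 h]; [by case: k|by case: k|by rewrite h ?eqxx in xy].
Qed.

Lemma not_weak_colour p q k x y : ~~ weak_colour p q k x y ->
  [/\ p x != p y, q x != q y & colour p q x y = ~~ k].
Proof.
rewrite /weak_colour; case: (ltgtP (p x) (p y)) => [pxy|pxy|_]; last 1 first.
- by case/negP; case: (k); rewrite /= 1?orbC le_total.
- by rewrite orbF => h; split => //; rewrite ?colour_lt //; case: k h; case: ltgtP.
- by rewrite /= => h; split => //; rewrite 1?colourC ?colour_lt //; case: k h; case: ltgtP.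
Qed.

Lemma cline_line rho p q S a b : box_metric rho p q -> generic p q S ->
    a \in S -> b \in S -> a != b ->
  cline (colour p q) S a b = line rho a b :&: S.
Proof.
move=> rhoE gS aS bS ab; apply/setP => x; rewrite in_cline in_setI andbC.
case xS: (x \in S); rewrite ?andbF // !andbT.
have pab : p a != p b by apply: contraNneq ab => /gS.1 ->.
have qab : q a != q b by apply: contraNneq ab => /gS.2 ->.
by rewrite (in_line_strict _ rhoE) // !(weak_colour_generic _ gS).
Qed.

Lemma mem_lines rho a b : a != b -> line rho a b \in lines rho.
Proof. by move=> ab; apply/imsetP; exists (a, b); rewrite // inE. Qed.

Lemma card_clines_lines rho p q S : box_metric rho p q -> generic p q S ->
  (#|clines (colour p q) S| <= #|lines rho|)%N.
Proof.
move=> rhoE gS; apply: leq_trans (leq_imset_card (fun L => L :&: S) _).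
apply/subset_leq_card/subsetP => L /clinesP[a [b [aS bS ab ->]]].
by apply/imsetP; exists (line rho a b); rewrite ?mem_lines // (cline_line rhoE gS).
Qed.

Definition no_universal_line rho := forall a b, a != b -> line rho a b != setT.

(** Two points of [dom] would span a universal line. Any other [x] in [K] has a [z] of strictly
    opposite colour, and points of [line rho x z] have that colour with [x], at least weakly; so the
    line meets [K] only in [x] and determines it. *)
Lemma card_clique rho p q K k : box_metric rho p q -> no_universal_line rho ->
    generic p q K -> {in K &, forall x y, x != y -> colour p q x y = k} ->
  (#|K| <= #|lines rho| + 1)%N.
Proof.
move=> rhoE no gK clq.
pose dom := [set x in K | [forall z, weak_colour p q k z x]].
have dom1 : (#|dom| <= 1)%N.
  apply/card_le1_eqP => a b; rewrite !inE => /andP[aK /forallP da] /andP[bK /forallP db].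
  apply/eqP/contraT => ab; case/negP: (no _ _ ab); apply/eqP/setP => x.
  have pab : p b != p a by apply: contraNneq ab => /gK.1 ->.
  have qab : q b != q a by apply: contraNneq ab => /gK.2 ->.
  by rewrite (in_line_strict _ rhoE) // clq // da db inE.
pose f x := if [pick z | ~~ weak_colour p q k z x] is Some z then line rho x z else set0.
have fP x : x \in K :\: dom -> exists2 z, ~~ weak_colour p q k z x & f x = line rho x z.
  rewrite !inE negb_and => /andP[/orP[/negbTE->//|/forallPn[z0 z0x]] xK].
  by rewrite /f; case: pickP => [z zx|/(_ z0)]; [exists z|rewrite z0x].
have neq x z : ~~ weak_colour p q k z x -> [/\ p x != p z, q x != q z & colour p q x z = ~~ k].
  by case/not_weak_colour => px qx c; rewrite eq_sym px eq_sym qx colourC.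
have -> : #|K| = (#|K :\: dom| + #|dom|)%N.
  rewrite addnC -(cardsID dom K); congr (_ + _)%N; apply: eq_card => x.
  by rewrite !inE; case: (x \in K).
apply: leq_add dom1; rewrite -(card_in_imset (f := f)).
  apply/subset_leq_card/subsetP => _ /imsetP[x /fP[z /neq[pxz _ _] ->] ->].
  by apply: mem_lines; apply: contraNneq pxz => ->.
move=> x y xK yK; have [z /neq[px qx cx] ->] := fP _ xK; have [w _ ->] := fP _ yK.
move=> E; apply/eqP/contraT => xy.
move: xK yK; rewrite !inE => /andP[_ xK] /andP[_ yK].
have : y \in line rho x z by rewrite E (in_line _ _ _ rhoE) !in_between_l orbT.
rewrite (in_line_strict _ rhoE) // cx => /andP[+ _].
rewrite (weak_colour_generic _ gK) // (eq_sym y) (negPf xy) colourC clq //=.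
by case: (k).
Qed.

(** * Points interior to their row, a row being a level set of [q] *)

Definition row_neighbours p q x (lr : T * T) : bool :=
  [&& q lr.1 == q x, q lr.2 == q x, p lr.1 < p x, p x < p lr.2
    & [forall z, (q z == q x) ==> (p lr.1 < p z < p lr.2) ==> (p z == p x)]].

Definition row_inner p q : {set T} := [set x | [exists lr, row_neighbours p q x lr]].

Lemma row_innerPn p q x : x \notin row_inner p q ->
  (forall y, q y = q x -> p x <= p y) \/ (forall y, q y = q x -> p y <= p x).
Proof.
rewrite inE => /existsPn nex.
have [/forallP h|/forallPn[l0]] := boolP [forall y, (q y == q x) ==> (p x <= p y)].
  by left=> y /eqP qy; exact: (implyP (h y)).
have [/forallP h|/forallPn[r0]] := boolP [forall y, (q y == q x) ==> (p y <= p x)].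
  by right=> y /eqP qy; exact: (implyP (h y)).
rewrite !negb_imply -!ltNge => r0P l0P.
(* The nearest points of the row on either side would be neighbours of [x]. *)
case: (@arg_maxP _ _ _ l0 (fun y => (q y == q x) && (p y < p x)) p l0P) => l /andP[ql lx] lmax.
case: (@arg_minP _ _ _ r0 (fun y => (q y == q x) && (p x < p y)) p r0P) => r /andP[qr xr] rmin.
case/negP: (nex (l, r)); rewrite /row_neighbours /= ql qr lx xr /=.
apply/forallP => z; apply/implyP => qz; apply/implyP => /andP[lz zr].
case: ltgtP => // [zx|xz].
  by have /= := lmax z; rewrite qz zx leNgt lz => /(_ isT).
by have /= := rmin z; rewrite qz xz leNgt zr => /(_ isT).
Qed.

Lemma row_line_separates rho p q a b : box_metric rho p q ->
    no_universal_line rho -> q a = q b -> p a < p b ->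
  exists z, [/\ p a < p z, p z < p b & q z != q a].
Proof.
move=> rhoE no qab pab; have ab : a != b by apply: contraTneq pab => ->; rewrite ltxx.
have : line rho a b != setT := no _ _ ab.
rewrite -subTset => /subsetPn[z _]; rewrite (in_line_row _ rhoE) //.
by rewrite !negb_or -!ltNge => /and3P[az zb qz]; exists z.
Qed.

(** If [x != y] gave the same line, [y] would be outside the [p]-interval from [l] to [r], and [x]
    outside the one from [l'] to [r']. The inequalities then form a cycle, or they put [z1] or [z2],
    which are off the line, into a half-plane of the line. *)
Lemma card_row_inner rho p q : box_metric rho p q ->
    (forall x y, p x = p y -> q x = q y -> x = y) ->
    no_universal_line rho ->
  (#|row_inner p q| <= #|lines rho|)%N.
Proof.
move=> rhoE pq_inj no.
pose f x := if [pick lr | row_neighbours p q x lr] is Some lr then line rho lr.1 lr.2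
            else set0.
have fP x : x \in row_inner p q ->
    exists2 lr, row_neighbours p q x lr & f x = line rho lr.1 lr.2.
  rewrite inE => /existsP[lr0 h0].
  by rewrite /f; case: pickP => [lr h|/(_ lr0)]; [exists lr|rewrite h0].
rewrite -(card_in_imset (f := f)).
  apply/subset_leq_card/subsetP => _ /imsetP[x /fP[[l r] /and5P[_ _ /= lx xr _] ->] ->].
  by apply: mem_lines; apply: contraTneq (lt_trans lx xr) => ->; rewrite ltxx.
move=> x y /fP[[l r] /and5P[/= /eqP ql /eqP qr lx xr /forallP nx] ->].
move=> /fP[[l' r'] /and5P[/= /eqP ql' /eqP qr' ly yr /forallP ny] ->] E.
have inE1 z : (z \in line rho l r) = [|| p z <= p l, p r <= p z | q z == q x].
  by rewrite (in_line_row _ rhoE) ?ql ?qr // (lt_trans lx xr).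
have inE2 z : (z \in line rho l r) = [|| p z <= p l', p r' <= p z | q z == q y].
  by rewrite E (in_line_row _ rhoE) ?ql' ?qr' // (lt_trans ly yr).
have [z1 [lz1 z1x qz1]] := row_line_separates rhoE no ql lx.
have [z2 [xz2 z2r qz2]] := row_line_separates rhoE no (esym qr) xr.
have [//|xy] := eqVneq x y.
have out1 : (p y <= p l) || (p r <= p y).
  have : y \in line rho l r by rewrite inE2 eqxx !orbT.
  rewrite inE1 => /or3P[->//|->|/eqP qyx]; rewrite ?orbT //.
  apply: contraNT xy; rewrite negb_or -!ltNge => yb.
  by move: (nx y); rewrite qyx eqxx yb /= => /eqP pyx; rewrite (pq_inj y x).
have out2 : (p x <= p l') || (p r' <= p x).
  have : x \in line rho l r by rewrite inE1 eqxx !orbT.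
  rewrite inE2 => /or3P[->//|->|/eqP qxy]; rewrite ?orbT //.
  apply: contraNT xy; rewrite negb_or -!ltNge => xb.
  by move: (ny x); rewrite qxy eqxx xb /= => /eqP pxy; rewrite (pq_inj x y).
have z1L : z1 \notin line rho l r.
  by rewrite inE1 -ql !negb_or -!ltNge lz1 qz1 (lt_trans z1x xr).
have z2L : z2 \notin line rho l r.
  by rewrite inE1 !negb_or -!ltNge z2r qz2 (lt_trans lx xz2).
have abs : (1 : R) <= 0 -> False by rewrite ler10.
case/orP: out1 => out1; case/orP: out2 => out2.
- by case: abs; lra.
- by case/negP: z2L; rewrite inE2 (le_trans out2 (ltW xz2)) orbT.
- by case/negP: z1L; rewrite inE2 (le_trans (ltW z1x) out2).
- by case: abs; lra.
Qed.

(** * Extreme points of rows and columns, and the final count *)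

Definition corner_class p q (s t : bool) : {set T} :=
  [set x | [forall y, ((q y == q x) ==> (if s then p x <= p y else p y <= p x))
                   && ((p y == p x) ==> (if t then q x <= q y else q y <= q x))]].

(** Two members in one column would both be its first point or both its last, hence equal; the same
    holds for rows. *)
Lemma corner_class_generic p q s t : (forall x y, p x = p y -> q x = q y -> x = y) ->
  generic p q (corner_class p q s t).
Proof.
move=> pq_inj; split=> x y; rewrite !inE => /forallP xm /forallP ym E.
  have := xm y; have := ym x; rewrite E eqxx /= => /andP[_ h1] /andP[_ h2].
  by apply: pq_inj => //; apply/eqP; rewrite eq_le; case: (t) h1 h2 => -> ->.
have := xm y; have := ym x; rewrite E eqxx /= => /andP[h1 _] /andP[h2 _].
by apply: pq_inj => //; apply/eqP; rewrite eq_le; case: (s) h1 h2 => -> ->.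
Qed.

(** With [N] lines, the two cliques have at most [N + 1] points each, and the peeling bound adds
    [N + 1]. *)
Lemma card_generic_set rho p q S : box_metric rho p q -> no_universal_line rho ->
    generic p q S ->
  (#|S| <= 3 * #|lines rho| + 3)%N.
Proof.
move=> rhoE no gS; have [K [KP leS]] := generic_peel gS.
have leK k : (#|K k| <= #|lines rho| + 1)%N.
  by have [KS clq] := KP k; apply: (card_clique rhoE no (genericS KS gS) clq).
have := leq_add (leq_add (leK true) (leK false)) (card_clines_lines rhoE gS).
move: leS; move: #|K true| #|K false| #|S| #|clines _ S| #|lines rho| => n1 n2 n3 n4 n5; lia.
Qed.

Lemma card_box_metric rho p q : box_metric rho p q ->
    (forall x y, p x = p y -> q x = q y -> x = y) ->
    no_universal_line rho ->
  (#|T| <= 14 * #|lines rho| + 12)%N.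
Proof.
move=> rhoE pq_inj no; pose C s t := corner_class p q s t.
have pq_inj' x y : q x = q y -> p x = p y -> x = y by move=> ? ?; apply: pq_inj.
have hr := card_row_inner rhoE pq_inj no.
have hc := card_row_inner (box_metricC rhoE) pq_inj' no.
have hC s t : (#|C s t| <= 3 * #|lines rho| + 3)%N.
  exact: card_generic_set rhoE no (corner_class_generic s t pq_inj).
(* Two families of interior points and four extreme classes give [2 N + 4 (3 N + 3) = 14 N + 12]. *)
have cov : [set: T] \subset (row_inner p q :|: row_inner q p)
    :|: (C true true :|: C true false) :|: (C false true :|: C false false).
  apply/subsetP => x _; rewrite !in_setU.
  have [//|/row_innerPn hx] := boolP (x \in row_inner p q).
  have [//|/row_innerPn hy] := boolP (x \in row_inner q p).
  have inC s t : (forall y, q y = q x -> if s then p x <= p y else p y <= p x) ->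
      (forall y, p y = p x -> if t then q x <= q y else q y <= q x) -> x \in C s t.
    move=> h1 h2; rewrite inE; apply/forallP => y.
    by apply/andP; split; apply/implyP => /eqP; [apply: h1|apply: h2].
  by case: hx hy => hx [] hy; [rewrite (inC true true)|rewrite (inC true false)|
    rewrite (inC false true)|rewrite (inC false false)]; rewrite ?orbT.
have := subset_leq_card cov; rewrite cardsT.
have U (A B : {set T}) : (#|A :|: B| <= #|A| + #|B|)%N by rewrite cardsU leq_subr.
have h1 := U (row_inner p q :|: row_inner q p :|: (C true true :|: C true false))
  (C false true :|: C false false).
have h2 := U (row_inner p q :|: row_inner q p) (C true true :|: C true false).
have h3 := U (row_inner p q) (row_inner q p).
have [h4 h5] := conj (U (C true true) (C true false)) (U (C false true) (C false false)).
move: (hC true true) (hC true false) (hC false true) (hC false false) => h6 h7 h8 h9 h0.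
apply: (leq_trans h0); clear -h1 h2 h3 h4 h5 h6 h7 h8 h9 hr hc.
apply: (leq_trans h1); apply: (leq_trans (leq_add h2 h5)).
apply: (leq_trans (leq_add (leq_add h3 h4) (leqnn _))).
move: h6 h7 h8 h9 hr hc.
move: #|C true true| #|C true false| #|C false true| #|C false false|
  #|row_inner p q| #|row_inner q p| #|lines rho|.
move=> n1 n2 n3 n4 n5 n6 n7; lia.
Qed.

Lemma generic_lines rho p q : box_metric rho p q -> generic p q [set: T] ->
    no_universal_line rho -> #|T| != 1%N ->
  (#|T| <= #|lines rho|)%N.
Proof.
move=> rhoE gT no T1; rewrite -cardsT in T1 *.
have [[a [b [aT bT ab E]]]|le] := generic_dbe gT T1.
  by move: E; rewrite (cline_line rhoE gT) // setIT => E; case/eqP: (no _ _ ab).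
exact: leq_trans le (card_clines_lines rhoE gT).
Qed.

End BoxMetric.

(** * The plane in diagonal coordinates *)

Section Plane.
Context {R : realType}.
Implicit Types u v w : R * R.

Local Open Scope ring_scope.

Lemma maxr_norm (s t : R) : 2 * Num.max `|s| `|t| = `|s + t| + `|s - t|.
Proof.
rewrite maxEle; case: leP;
  case: (ger0P s) => hs; case: (ger0P t) => ht;
  case: (ger0P (s + t)) => h1; case: (ger0P (s - t)) => h2; lra.
Qed.

Lemma dist_Linf_diagonal u v :
  2 * dist_Linf u v = `|(u.1 + u.2) - (v.1 + v.2)| + `|(u.1 - u.2) - (v.1 - v.2)|.
Proof.
by rewrite /dist_Linf maxr_norm; congr (_ + _); congr (Num.norm _); lra.
Qed.

Lemma distrD_in_between (s t r : R) :
  (`|s - t| == `|s - r| + `|r - t|) = (s <= r <= t) || (t <= r <= s).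
Proof.
apply/eqP/orP => [h|[]/andP[h1 h2]]; last 2 first.
- by rewrite !ler0_norm ?subr_le0 ?(le_trans h1 h2) //; lra.
- by rewrite !ger0_norm ?subr_ge0 ?(le_trans h1 h2) //; lra.
have := (ler_norm (s - r), ler_norm (r - t), ler_norm (- (s - r)), ler_norm (- (r - t))).
rewrite !normrN => -[[[n1 n2] n3] n4]; move: h.
by case: (ger0P (s - t)) => st h; [right|left]; apply/andP; split; lra.
Qed.

(** Twice the distance is the sum of the two coordinate distances, so the triangle inequality is an
    equality exactly when it is one in both coordinates. *)
Lemma dist_Linf_box (X : {fset R * R}) :
  box_metric (@dist_Linf_on R X) (fun x => (val x).1 + (val x).2)
    (fun x => (val x).1 - (val x).2).
Proof.
move=> a x b; rewrite /between /dist_Linf_on /in_between -!distrD_in_between.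
have dbl u v := dist_Linf_diagonal u v.
have := (dbl (val a) (val b), dbl (val a) (val x), dbl (val x) (val b)).
move: (dist_Linf _ _) (dist_Linf _ _) (dist_Linf _ _) => d1 d2 d3.
set a1 := (val a).1 + _; set b1 := (val b).1 + _; set x1 := (val x).1 + _.
set a2 := (val a).1 - _; set b2 := (val b).1 - _; set x2 := (val x).1 - _.
move=> [[e1 e2] e3]; have t1 := ler_distD x1 a1 b1; have t2 := ler_distD x2 a2 b2.
by apply/eqP/andP => [h|[/eqP h1 /eqP h2]]; [split; apply/eqP|]; lra.
Qed.

End Plane.

Local Open Scope ring_scope.

Theorem theorem3 (R : realType) (X : {fset R * R}) (n : nat)
    (hn : #|{: X}| = n) (hn1 : n <> 1%N) :
  ((exists2 L : {set X}, L \in lines (@dist_Linf_on R X) & forall x : X, x \in L)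
   \/ n%:R / 37%:R <= #|lines (@dist_Linf_on R X)|%:R :> R)
  /\
  ((forall u v : R * R, u \in X -> v \in X -> u <> v ->
      `|u.1 - v.1| <> `|u.2 - v.2|) ->
   (exists2 L : {set X}, L \in lines (@dist_Linf_on R X) & forall x : X, x \in L)
   \/ (n <= #|lines (@dist_Linf_on R X)|)%N).
Proof.
set rho := @dist_Linf_on R X.
have boxX := @dist_Linf_box R X.
have [/exists_inP[L LX /eqP LT]|no] := boolP [exists L in lines rho, L == setT].
  by split=> [|_]; left; exists L => // x; rewrite LT inE.
have noX : no_universal_line rho.
  move=> a b ab; apply: contraNneq no => LT; apply/exists_inP.
  by exists (line rho a b); [exact: mem_lines|exact/eqP].
split=> [|gen]; right.
  have pq_inj (x y : X) : ((val x).1 + (val x).2 = (val y).1 + (val y).2)%R ->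
      ((val x).1 - (val x).2 = (val y).1 - (val y).2)%R -> x = y.
    move=> e1 e2; apply: val_inj; rewrite [val x]surjective_pairing [val y]surjective_pairing.
    by congr pair; lra.
  have := card_box_metric boxX pq_inj noX; rewrite hn => le.
  case: (ltngtP n 1%N) hn1 => // [n0|n1] _.
    by move: n0; rewrite ltnS leqn0 => /eqP->; rewrite mul0r ler0n.
  have lines_pos : (0 < #|lines rho|)%N.
    have /card_gt1P[a [b [_ _ ab]]] : (1 < #|{: X}|)%N by rewrite hn.
    by apply/card_gt0P; exists (line rho a b); exact: mem_lines.
  (* With at least one line, [14 N + 12 <= 26 N <= 37 N]. *)
  rewrite ler_pdivrMr ?ltr0n // -natrM ler_nat.
  by move: le lines_pos; move: #|lines rho| => m; clear; lia.
rewrite -hn; apply: (generic_lines boxX) => //; last by rewrite hn; apply/eqP.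
(* Points with equal coordinate sums, or equal differences, differ by the same absolute value in
   both original coordinates, which [gen] forbids. *)
split=> x y _ _ E; apply: val_inj; apply/eqP/negPn/negP => /eqP xy;
  apply: (gen _ _ (valP x) (valP y) xy).
  by rewrite -normrN; congr (Num.norm _); lra.
by congr (Num.norm _); lra.
Qed.
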